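(* (a) The pair $(\mathrm{lpk},\mathrm{des})$ is shuffle-compatible. (b) The linear map on $\mathcal{A}_{(\mathrm{lpk},\mathrm{des})}$ defined by $[\pi]\mapsto\frac{t^{\mathrm{lpk}(\pi)}(y+t)^{\mathrm{des}(\pi)-\mathrm{lpk}(\pi)}(1+yt)^{|\pi|-\mathrm{lpk}(\pi)-\mathrm{des}(\pi)}(1+y)^{2\mathrm{lpk}(\pi)}}{(1-t)^{|\pi|+1}}x^{|\pi|}$ if $|\pi|\ge1$ and $[\pi]\mapsto1/(1-t)$ if $|\pi|=0$ is a $\mathbb{Q}$-algebra isomorphism from $\mathcal{A}_{(\mathrm{lpk},\mathrm{des})}$ to the span of $\{\frac1{1-t}\}\cup\{\frac{(1+yt)^n}{(1-t)^{n+1}}x^n\}_{n\ge1}\cup\{\frac{t^j(y+t)^{k-j}(1+yt)^{n-j-k}(1+y)^{2j}}{(1-t)^{n+1}}x^n\}_{n\ge2,\,1\le j\le\lfloor n/2\rfloor,\,j\le k\le n-j}$, a subalgebra of $\mathbb{Q}[[t*]][x,y]$. (c) The $n$th homogeneous component of $\mathcal{A}_{(\mathrm{lpk},\mathrm{des})}$ has dimension $\lfloor n^2/4\rfloor+1$.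
   Context: A permutation of length $n$ is a sequence $\pi=\pi_1\cdots\pi_n$ of distinct positive integers. $\mathrm{des}(\pi)$ is the number of $i\in[n-1]$ with $\pi_i>\pi_{i+1}$. A peak is an index $2\le i\le n-1$ with $\pi_{i-1}<\pi_i>\pi_{i+1}$; a left peak is an $i\in[n-1]$ that is a peak or is $i=1$ with $\pi_1>\pi_2$; $\mathrm{lpk}(\pi)$ is the number of left peaks. For disjoint permutations, $S(\pi,\sigma)$ is the set of shuffles (permutations of length $|\pi|+|\sigma|$ containing both as subsequences). A statistic $\mathrm{st}$ is shuffle-compatible if for disjoint $\pi,\sigma$ the multiset $\{\mathrm{st}(\tau):\tau\in S(\pi,\sigma)\}$ depends only on $\mathrm{st}(\pi),\mathrm{st}(\sigma),|\pi|,|\sigma|$; its shuffle algebra $\mathcal{A}_{\mathrm{st}}$ has basis the classes $[\pi]$ of permutations with equal length and $\mathrm{st}$-value, product $[\pi][\sigma]=\sum_{\tau\in S(\pi,\sigma)}[\tau]$, graded by length. $\mathbb{Q}[[t*]][x,y]$ denotes polynomials in $x,y$ with coefficients formal power series in $t$, with multiplication ordinary in $x,y$ and the Hadamard product $(\sum a_nt^n)*(\sum b_nt^n)=\sum a_nb_nt^n$ in $t$. *)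

(* Defs.v *)
From HB Require Import structures.
From mathcomp Require Import all_boot all_order all_algebra generic_quotient.
From mathcomp Require Import boolp classical_sets.
From mathcomp Require Import finmap monalg.
From mathcomp Require Import zify.

Set Implicit Arguments.
Unset Strict Implicit.
Unset Printing Implicit Defensive.

Import GRing.Theory.

Local Open Scope ring_scope.
Local Open Scope classical_set_scope.
Local Open Scope quotient_scope.

(* Permutations are words of distinct positive integers, not bijections. *)
Definition permutation := {s : seq nat | uniq s && (0%N \notin s)}.

Definition len (p : permutation) : nat := size (val p).

(* [letter p i] is the i-th letter of p, with indices starting at 1. *)
Definition letter (p : permutation) (i : nat) : nat := nth 0%N (val p) i.-1.

(* [iota 1 n.-1] enumerates the indices 1, ..., n - 1. *)
Definition des (p : permutation) : nat :=
  count (fun i => letter p i > letter p i.+1)%N (iota 1 (len p).-1).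

Definition is_peak (p : permutation) (i : nat) : bool :=
  [&& 2 <= i, i <= (len p).-1, letter p i.-1 < letter p i
    & letter p i > letter p i.+1]%N.

Definition is_left_peak (p : permutation) (i : nat) : bool :=
  is_peak p i || (i == 1%N) && (letter p 1 > letter p 2)%N.

Definition lpk (p : permutation) : nat :=
  count (is_left_peak p) (iota 1 (len p).-1).

Definition lpkdes (p : permutation) : nat * nat := (lpk p, des p).

Definition disjoint_perm (p q : permutation) : bool :=
  ~~ has (mem (val p)) (val q).

(* The elements of S(p, q), listed without repetition; see [mem_shuffles] and
   [shuffles_uniq]. *)
Definition shuffles (p q : permutation) : seq permutation :=
  pmap insub [seq s <- permutations (val p ++ val q)
             | subseq (val p) s && subseq (val q) s].

Lemma shuffles_uniq (p q : permutation) : uniq (shuffles p q).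
Proof.
by apply: pmap_sub_uniq; apply: filter_uniq; apply: permutations_uniq.
Qed.

Lemma mem_shuffles (p q r : permutation) : disjoint_perm p q ->
  (r \in shuffles p q) =
  [&& len r == (len p + len q)%N, subseq (val p) (val r)
    & subseq (val q) (val r)].
Proof.
move=> dpq; rewrite /shuffles mem_pmap_sub mem_filter mem_permutations.
rewrite andbC; apply/andP/andP => -[].
  by move=> /perm_size; rewrite size_cat /len => -> ->.
move=> /eqP szr /andP[spr sqr]; split; last by rewrite spr sqr.
have /andP[up _] := valP p; have /andP[uq _] := valP q.
have /andP[ur _] := valP r.
have upq : uniq (val p ++ val q) by rewrite cat_uniq up uq andbT.
rewrite perm_sym; apply: uniq_perm => //.
apply: (uniq_min_size upq _ _).2; last by rewrite size_cat -/(len r) szr.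
move=> x; rewrite mem_cat => /orP[xp|xq].
  exact: (mem_subseq spr).
exact: (mem_subseq sqr).
Qed.

(* Equality of multisets is [perm_eq]. *)
Definition shuffle_compatible (T : eqType) (st : permutation -> T) : Prop :=
  forall p q p' q' : permutation,
    disjoint_perm p q -> disjoint_perm p' q' ->
    st p = st p' -> st q = st q' -> len p = len p' -> len q = len q' ->
    perm_eq (map st (shuffles p q)) (map st (shuffles p' q')).

Section ShuffleAlgebra.
Variables (T : eqType) (st : permutation -> T).

Definition st_eqv : rel permutation :=
  fun p q => (len p == len q) && (st p == st q).

Lemma st_eqv_refl : reflexive st_eqv.
Proof. by move=> p; rewrite /st_eqv !eqxx. Qed.

Lemma st_eqv_sym : symmetric st_eqv.
Proof. by move=> p q; rewrite /st_eqv eq_sym [st p == _]eq_sym. Qed.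

Lemma st_eqv_trans : transitive st_eqv.
Proof.
by move=> q p r /andP[/eqP h1 /eqP h2] /andP[/eqP h3 /eqP h4];
  rewrite /st_eqv h1 h2 h3 h4 !eqxx.
Qed.

Canonical st_equiv :=
  EquivRel st_eqv st_eqv_refl st_eqv_sym st_eqv_trans.

Definition st_class := {eq_quot st_eqv}.

HB.instance Definition _ := Choice.on st_class.

Definition shuffle_alg := {malg rat[st_class]}.

HB.instance Definition _ := GRing.Lmodule.on shuffle_alg.

Definition cls (p : permutation) : shuffle_alg :=
  << (\pi_st_class p : st_class) >>.

Lemma empty_subproof : uniq ([::] : seq nat) && (0%N \notin [::]).
Proof. by []. Qed.

Definition empty_perm : permutation := Sub [::] empty_subproof.

Definition shuffle_one : shuffle_alg := cls empty_perm.

(* The product of two basis elements is computed on chosen disjoint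
   representatives, which exist as soon as st depends only on the relative
   order of the letters (shift the letters of one of them); by [shuffle_mulE]
   the choice is immaterial when st is shuffle-compatible. *)
Definition disjoint_reprs (c d : st_class) : permutation * permutation :=
  xget (empty_perm, empty_perm)
    [set pq | [/\ disjoint_perm pq.1 pq.2, \pi_st_class pq.1 = c
                & \pi_st_class pq.2 = d]].

Definition class_mul (c d : st_class) : shuffle_alg :=
  \sum_(r <- shuffles (disjoint_reprs c d).1 (disjoint_reprs c d).2) cls r.

Definition shuffle_mul (u v : shuffle_alg) : shuffle_alg :=
  \sum_(c <- msupp u) \sum_(d <- msupp v) (u@_c * v@_d) *: class_mul c d.

Lemma len_shuffles (p q r : permutation) :
  r \in shuffles p q -> len r = (len p + len q)%N.
Proof.
rewrite /shuffles mem_pmap_sub mem_filter mem_permutations.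
by move=> /andP[_ /perm_size]; rewrite size_cat.
Qed.

Lemma shuffle_mulE (p q : permutation) :
  shuffle_compatible st -> disjoint_perm p q ->
  shuffle_mul (cls p) (cls q) = \sum_(r <- shuffles p q) cls r.
Proof.
move=> sc dpq.
rewrite /shuffle_mul /cls !msuppU !oner_eq0 !big_seq_fset1 !mcoeffUU.
rewrite mulr1 scale1r /class_mul /disjoint_reprs.
case: xgetP => [[p' q'] _ [/= dpq' ep eq]|/(_ (p, q)) []]; last by [].
move/eqmodP: ep => /andP[/eqP lp /eqP sp].
move/eqmodP: eq => /andP[/eqP lq /eqP sq].
have pe := sc _ _ _ _ dpq' dpq sp sq lp lq.
pose F (n : nat) (x : T) : shuffle_alg :=
  oapp cls 0 (ohead [seq r <- shuffles p' q' ++ shuffles p q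
                    | (len r == n) && (st r == x)]).
have FE r : r \in shuffles p' q' ++ shuffles p q ->
    cls r = F (len p + len q)%N (st r).
  move=> rin.
  have lr : len r = (len p + len q)%N.
    by move: rin; rewrite mem_cat => /orP[] /len_shuffles -> //; rewrite lp lq.
  rewrite /F; set s := [seq _ <- _ | _].
  have : r \in s by rewrite mem_filter lr !eqxx.
  have : all (fun a => (len a == len p + len q)%N && (st a == st r)) s.
    exact: filter_all.
  case: s => //= a s /andP[/andP[/eqP la /eqP sa] _] _.
  by rewrite /cls; congr << _ >>; apply/eqmodP; rewrite /= /st_eqv lr la sa !eqxx.
transitivity (\sum_(x <- map st (shuffles p' q')) F (len p + len q)%N x).
  rewrite big_map !big_seq; apply: eq_bigr => r rin.
  by apply: FE; rewrite mem_cat rin.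
rewrite (perm_big _ pe) big_map !big_seq; apply: eq_bigr => r rin.
by rewrite -FE // mem_cat rin orbT.
Qed.

End ShuffleAlgebra.

Definition lin_span (V : lmodType rat) (X : set V) : set V :=
  [set v | exists s : seq (rat * V),
     (forall a, a \in s -> X a.2) /\ v = \sum_(a <- s) a.1 *: a.2].

Definition has_dim (V : lmodType rat) (W : set V) (d : nat) : Prop :=
  exists b : 'I_d -> V,
    (forall c : 'I_d -> rat, \sum_i c i *: b i = 0 -> forall i, c i = 0) /\
    (forall v, W v <-> exists c : 'I_d -> rat, v = \sum_i c i *: b i).

Definition hom_component (T : eqType) (st : permutation -> T) (n : nat) :
    set (shuffle_alg st) :=
  lin_span [set cls st p | p in [set p | len p = n]].
Arguments hom_component {T} st n.

(* Formal power series over rat, with the Cauchy product. *)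
Record fps := Fps { fcoef : nat -> rat }.
HB.instance Definition _ := [isNew for fcoef].
HB.instance Definition _ := [Choice of fps by <:].

Section Fps.
Implicit Types f g h : fps.

Lemma fpsP f g : (forall n, fcoef f n = fcoef g n) -> f = g.
Proof. by move=> fg; apply: val_inj; apply: funext. Qed.

Definition fps_add f g := Fps (fun n => fcoef f n + fcoef g n).
Definition fps_opp f := Fps (fun n => - fcoef f n).
Definition fps_zero := Fps (fun=> 0).
Definition fps_one := Fps (fun n => (n == 0%N)%:R).
Definition fps_mul f g :=
  Fps (fun n => \sum_(i < n.+1) fcoef f i * fcoef g (n - i)%N).

Lemma fps_addA : associative fps_add.
Proof. by move=> f g h; apply: fpsP => n /=; rewrite addrA. Qed.
Lemma fps_addC : commutative fps_add.
Proof. by move=> f g; apply: fpsP => n /=; rewrite addrC. Qed.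
Lemma fps_add0 : left_id fps_zero fps_add.
Proof. by move=> f; apply: fpsP => n /=; rewrite add0r. Qed.
Lemma fps_addN : left_inverse fps_zero fps_opp fps_add.
Proof. by move=> f; apply: fpsP => n /=; rewrite addNr. Qed.

HB.instance Definition _ :=
  GRing.isZmodule.Build fps fps_addA fps_addC fps_add0 fps_addN.

Definition fps_trunc (m : nat) f : {poly rat} := \poly_(i < m.+1) fcoef f i.

Lemma truncM m n f g : (n <= m)%N ->
  (fps_trunc m f * fps_trunc m g)`_n = fcoef (fps_mul f g) n.
Proof.
move=> nm; rewrite coefM /=; apply: eq_bigr => i _.
rewrite !coef_poly !ltnS (leq_trans _ nm) ?(leq_trans (leq_subr _ _) nm) //.
by rewrite -ltnS.
Qed.

Lemma fps_mulC : commutative fps_mul.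
Proof.
by move=> f g; apply: fpsP => n; rewrite -!(truncM (m := n)) // mulrC.
Qed.
Lemma fps_mulA : associative fps_mul.
Proof.
move=> f g h; apply: fpsP => n.
have aux a b c :
    fcoef (fps_mul a (fps_mul b c)) n = (fps_trunc n a * (fps_trunc n b * fps_trunc n c))`_n.
  rewrite coefM; apply: eq_bigr => i _; rewrite truncM ?leq_subr //.
  by rewrite coef_poly ltn_ord.
by rewrite (fps_mulC (fps_mul f g) h) !aux mulrA mulrC.
Qed.
Lemma fps_mul1 : left_id fps_one fps_mul.
Proof.
move=> f; apply: fpsP => n /=; rewrite big_ord_recl /= mul1r subn0.
by rewrite big1 ?addr0 // => i _; rewrite mul0r.
Qed.
Lemma fps_mulD : left_distributive fps_mul fps_add.
Proof.
move=> f g h; apply: fpsP => n /=; rewrite -big_split /=.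
by apply: eq_bigr => i _; rewrite mulrDl.
Qed.
Lemma fps_oner_neq0 : fps_one != 0.
Proof. by apply/eqP => /(congr1 (fcoef^~ 0%N)). Qed.

HB.instance Definition _ := GRing.Zmodule_isComNzRing.Build fps
  fps_mulA fps_mulC fps_mul1 fps_mulD fps_oner_neq0.

Definition fps_unit : {pred fps} := fun f => `[< exists g, g * f = 1 >].
Definition fps_inv f : fps := if f \in fps_unit then xget 0 [set g | g * f = 1] else f.

Lemma fps_mulVr : {in fps_unit, left_inverse 1 fps_inv *%R}.
Proof.
move=> f uf; rewrite /fps_inv uf.
exact: (@xgetPex _ 0 [set g | g * f = 1] (asboolP _ uf)).
Qed.
Lemma fps_unitP f g : g * f = 1 -> f \in fps_unit.
Proof. by move=> gf; apply/asboolP; exists g. Qed.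
Lemma fps_inv_out : {in [predC fps_unit], fps_inv =1 id}.
Proof. by move=> f /negbTE uf; rewrite /fps_inv uf. Qed.

HB.instance Definition _ :=
  GRing.ComNzRing_hasMulInverse.Build fps fps_mulVr fps_unitP fps_inv_out.

End Fps.

Definition fps_t : fps := Fps (fun n => (n == 1%N)%:R).

Lemma geometric_series : Fps (fun=> 1) * (1 - fps_t) = 1.
Proof.
apply: fpsP => n; rewrite mulrBr mulr1 /=.
case: n => [|n]; first by rewrite big_ord1 mulr0 subr0.
rewrite (bigD1 (Ordinal (_ : n < n.+2)%N)) //= subSnn eqxx mul1r.
rewrite big1 ?addr0 ?subrr // => i ni; rewrite mul1r.
case: eqP => // e; case/negP: ni; apply/eqP/val_inj => /=.
by have := ltn_ord i; move: e => /=; lia.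
Qed.

Lemma unit_1Bt : 1 - fps_t \is a GRing.unit.
Proof. exact: fps_unitP geometric_series. Qed.

Lemma inv_1Bt : (1 - fps_t)^-1 = Fps (fun=> 1).
Proof.
by rewrite -[RHS](mulrK unit_1Bt) geometric_series mul1r.
Qed.

(* Formal power series over rat, with the Hadamard product. *)
Record hps := Hps { hcoef : nat -> rat }.
HB.instance Definition _ := [isNew for hcoef].
HB.instance Definition _ := [Choice of hps by <:].

Section Hps.
Implicit Types f g h : hps.

Lemma hpsP f g : (forall n, hcoef f n = hcoef g n) -> f = g.
Proof. by move=> fg; apply: val_inj; apply: funext. Qed.

Definition hps_add f g := Hps (fun n => hcoef f n + hcoef g n).
Definition hps_opp f := Hps (fun n => - hcoef f n).
Definition hps_zero := Hps (fun=> 0).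
Definition hps_one := Hps (fun=> 1).
Definition hps_mul f g := Hps (fun n => hcoef f n * hcoef g n).

Lemma hps_addA : associative hps_add.
Proof. by move=> f g h; apply: hpsP => n /=; rewrite addrA. Qed.
Lemma hps_addC : commutative hps_add.
Proof. by move=> f g; apply: hpsP => n /=; rewrite addrC. Qed.
Lemma hps_add0 : left_id hps_zero hps_add.
Proof. by move=> f; apply: hpsP => n /=; rewrite add0r. Qed.
Lemma hps_addN : left_inverse hps_zero hps_opp hps_add.
Proof. by move=> f; apply: hpsP => n /=; rewrite addNr. Qed.

HB.instance Definition _ :=
  GRing.isZmodule.Build hps hps_addA hps_addC hps_add0 hps_addN.

Lemma hps_mulA : associative hps_mul.
Proof. by move=> f g h; apply: hpsP => n /=; rewrite mulrA. Qed.
Lemma hps_mulC : commutative hps_mul.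
Proof. by move=> f g; apply: hpsP => n /=; rewrite mulrC. Qed.
Lemma hps_mul1 : left_id hps_one hps_mul.
Proof. by move=> f; apply: hpsP => n /=; rewrite mul1r. Qed.
Lemma hps_mulD : left_distributive hps_mul hps_add.
Proof. by move=> f g h; apply: hpsP => n /=; rewrite mulrDl. Qed.
Lemma hps_oner_neq0 : hps_one != 0.
Proof. by apply/eqP => /(congr1 (hcoef^~ 0%N)). Qed.

HB.instance Definition _ := GRing.Zmodule_isComNzRing.Build hps
  hps_mulA hps_mulC hps_mul1 hps_mulD hps_oner_neq0.

End Hps.

(* Q[[t*]][x,y]: the outer variable is x, the inner one is y. *)
Definition hpoly := {poly {poly hps}}.

HB.instance Definition _ := GRing.ComNzRing.on hpoly.

Definition hconst (a : rat) : hpoly := (Hps (fun=> a))%:P%:P.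
Definition hpoly_scale (a : rat) (p : hpoly) : hpoly := hconst a * p.

Lemma hconstM a b : hconst (a * b) = hconst a * hconst b.
Proof. by rewrite /hconst -!polyCM. Qed.
Lemma hconstD a b : hconst (a + b) = hconst a + hconst b.
Proof. by rewrite /hconst -!polyCD. Qed.
Lemma hpoly_scaleA a b p :
  hpoly_scale a (hpoly_scale b p) = hpoly_scale (a * b) p.
Proof. by rewrite /hpoly_scale hconstM mulrA. Qed.
Lemma hpoly_scale1 : left_id 1 hpoly_scale.
Proof. by move=> p; rewrite /hpoly_scale /hconst mul1r. Qed.
Lemma hpoly_scaleDr : right_distributive hpoly_scale +%R.
Proof. by move=> a p q; rewrite /hpoly_scale mulrDr. Qed.
Lemma hpoly_scaleDl p : {morph hpoly_scale^~ p : a b / a + b}.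
Proof. by move=> a b; rewrite /hpoly_scale hconstD mulrDl. Qed.

HB.instance Definition _ := GRing.Zmodule_isLmodule.Build rat hpoly
  hpoly_scaleA hpoly_scale1 hpoly_scaleDr hpoly_scaleDl.

Lemma hpoly_scaleAl (a : rat) (p q : hpoly) : a *: (p * q) = a *: p * q.
Proof. exact: mulrA. Qed.

HB.instance Definition _ := GRing.Lmodule_isLalgebra.Build rat hpoly
  hpoly_scaleAl.
HB.instance Definition _ := GRing.Lalgebra_isComAlgebra.Build rat hpoly.

(* Quotients such as (1 + y t)^n / (1 - t)^(n + 1) are computed with the
   ordinary product of power series, in Q[[t]][x,y], and only then regarded,
   through [hadamard], as elements of Q[[t*]][x,y]. *)
Definition fpoly := {poly {poly fps}}.

Definition hadamard (p : fpoly) : hpoly :=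
  map_poly (map_poly (fun f : fps => Hps (fcoef f))) p.

Definition var_x : fpoly := 'X.
Definition var_y : fpoly := 'X%:P.
Definition var_t : fpoly := fps_t%:P%:P.
Definition over_1Bt (k : nat) : fpoly := ((1 - fps_t) ^- k)%:P%:P.

Definition unit_elt : hpoly := hadamard (over_1Bt 1).

Definition lpkdes_term (j k n : nat) : hpoly :=
  hadamard (var_t ^+ j * (var_y + var_t) ^+ (k - j)
            * (1 + var_y * var_t) ^+ (n - j - k) * (1 + var_y) ^+ (2 * j)
            * over_1Bt n.+1 * var_x ^+ n).

Definition lpkdes_image (p : permutation) : hpoly :=
  if (1 <= len p)%N then lpkdes_term (lpk p) (des p) (len p) else unit_elt.

Definition lpkdes_span : set hpoly :=
  lin_span ([set unit_elt]
    `|` [set p | exists n : nat, (1 <= n)%N /\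
           p = hadamard ((1 + var_y * var_t) ^+ n * over_1Bt n.+1 * var_x ^+ n)]
    `|` [set p | exists n j k : nat,
           [/\ (2 <= n)%N, (1 <= j <= n %/ 2)%N, (j <= k <= n - j)%N
             & p = lpkdes_term j k n]]).

(* Main.v *)
(* Specialise the fundamental quasisymmetric function of a word w to the ordered
   super-alphabet e_0 < o_1 < e_1 < ... < o_m < e_m, the odd letters having
   weight y: sum over the weakly increasing assignments of letters to the
   positions of w in which an even (odd) letter is repeated only along ascents
   (descents).  Call the result F_m(w).  The assignments using a single letter
   give a character of the shuffle algebra, and F_m is the convolution, with
   respect to deconcatenation, of 2m+1 such characters, so
   F_m(u) F_m(v) = sum of F_m(w) over the shuffles w of u and v.
   Computing sum_m t^m F_m(w) letter by letter is a transfer-matrix computation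
   with one 2x2 matrix for ascents, (1,1)^T (1,ty)/(1-t), and one for descents,
   (t,1)^T (1,y)/(1-t).  Both have rank one, so the sum is a product of scalars
   1+ty, t(1+y), 1+y, t+y over 1-t, one for each pair of consecutive steps; it
   is the image of [w] in the theorem.  Since the Hadamard product multiplies the
   coefficients of t^m, this gives multiplicativity.  The images are linearly
   independent because the coefficient of t^j y^(k-j) is lexicographically
   triangular in (j,k); shuffle-compatibility, injectivity and the dimension
   count follow. *)

Require Import Defs.
From HB Require Import structures.
From mathcomp Require Import all_boot all_order all_algebra.
From mathcomp Require Import boolp classical_sets.
From mathcomp Require Import generic_quotient finmap monalg zify ring.
Set Implicit Arguments.
Unset Strict Implicit.
Unset Printing Implicit Defensive.
Import GRing.Theory.
Local Open Scope ring_scope.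

(** * Recursive shuffles of words and deconcatenation *)

Section Shuffle.
Variable T : eqType.
Implicit Types (a b : T) (r s t u v : seq T).

(** Recursion on first letters makes sums over shuffles accessible to induction; [perm_shuffles]
    matches this list with [shuffles]. *)
Fixpoint shuffle s : seq T -> seq (seq T) :=
  if s is a :: s' then
    fix shuffle_s t := if t is b :: t' then
      map (cons a) (shuffle s' t) ++ map (cons b) (shuffle_s t') else [:: s]
  else fun t => [:: t].

Lemma shuffles0 s : shuffle s [::] = [:: s].
Proof. by case: s. Qed.

Lemma shuffle_cons a s b t : shuffle (a :: s) (b :: t) =
  map (cons a) (shuffle s (b :: t)) ++ map (cons b) (shuffle (a :: s) t).
Proof. by []. Qed.

Lemma shuffle_ind (P : seq T -> seq T -> Prop) :
  (forall t, P [::] t) -> (forall s, P s [::]) ->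
  (forall a s b t, P s (b :: t) -> P (a :: s) t -> P (a :: s) (b :: t)) ->
  forall s t, P s t.
Proof.
move=> P0t Ps0 Pst; elim=> // a s IHs; elim=> // b t IHt.
by apply: Pst.
Qed.

Lemma disjoint_cons a s b t : ~~ has (mem (a :: s)) (b :: t) ->
  [/\ a != b, ~~ has (mem s) (b :: t) & ~~ has (mem (a :: s)) t].
Proof.
rewrite /= inE !negb_or eq_sym => /andP[/andP[ab bs] nt].
split=> //=; rewrite ?negb_or ?bs; apply: contra nt.
by apply: sub_has => x; rewrite !inE => ->; rewrite orbT.
Qed.

Lemma mem_shuffle s t r : uniq (s ++ t) ->
  (r \in shuffle s t) = [&& perm_eq r (s ++ t), subseq s r & subseq t r].
Proof.
move: s t r; apply: shuffle_ind => [t r _|s r _|a s b t IHs IHt r ust].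
- rewrite inE sub0seq /=; apply/eqP/andP => [->|[/perm_size sz st]].
    by rewrite perm_refl subseq_refl.
  by apply/eqP; rewrite eq_sym -(size_subseq_leqif st).2 sz.
- rewrite shuffles0 inE sub0seq andbT cats0 /=.
  apply/eqP/andP => [->|[/perm_size sz st]].
    by rewrite perm_refl subseq_refl.
  by apply/eqP; rewrite eq_sym -(size_subseq_leqif st).2 sz.
have := ust; rewrite cat_uniq => /and3P[_ /disjoint_cons[ab _ _] _].
rewrite shuffle_cons mem_cat.
case: r => [|c r].
  rewrite andbF; apply/negbTE; rewrite negb_or.
  by apply/andP; split; apply/negP => /mapP[].
have memc d S : (c :: r \in map (cons d) S) = (c == d) && (r \in S).
  apply/mapP/andP => [[x xS [-> ->]]|[/eqP-> rS]]; last by exists r.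
  by rewrite eqxx.
have perm_ct : perm_eq ((a :: s) ++ b :: t) (b :: (a :: s) ++ t).
  exact: permEl (perm_catCA (a :: s) [:: b] t).
have := ust; rewrite (perm_uniq perm_ct) cons_uniq => /andP[_ ust2].
have /= /andP[_ ust1] := ust.
rewrite !memc IHs // IHt // -cat_cons [a == c]eq_sym [b == c]eq_sym.
have [->|ca] := eqVneq c a; first by rewrite (negbTE ab) orbF /= perm_cons.
have [->|cb] := eqVneq c b; first by rewrite (permPr perm_ct) perm_cons.
(* A first letter other than [a] and [b] would lie in [s] or [t], hence again in [r], against
   distinctness. *)
apply/esym/negbTE; apply/negP => /and3P[pe sr tr].
move: ust; rewrite -(perm_uniq pe) /= => /andP[/negP cr _]; apply: cr.
have := perm_mem pe c; rewrite mem_cat !inE eqxx (negbTE ca) (negbTE cb) /=.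
case/esym/orP=> [cs|ct].
  by apply: (mem_subseq sr); rewrite inE cs orbT.
by apply: (mem_subseq tr); rewrite inE ct orbT.
Qed.

Lemma shuffle_uniq s t : ~~ has (mem s) t -> uniq (shuffle s t).
Proof.
move: s t; apply: shuffle_ind => [t _|s _|a s b t IHs IHt].
- by [].
- by rewrite shuffles0.
case/disjoint_cons => ab ds dt; rewrite shuffle_cons cat_uniq.
rewrite !map_inj_uniq ?IHs ?IHt ?andbT //=; try by move=> x y [].
apply/hasPn => _ /mapP[x _ ->]; apply/negP => /mapP[y _ [ba _]].
by rewrite ba eqxx in ab.
Qed.

Lemma size_shuffle s t r : r \in shuffle s t -> size r = (size s + size t)%N.
Proof.
move: s t r; apply: shuffle_ind => [t r|s r|a s b t IHs IHt r].
- by rewrite inE => /eqP->.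
- by rewrite shuffles0 inE => /eqP->; rewrite addn0.
rewrite shuffle_cons mem_cat => /orP[] /mapP[u u_in ->] /=.
  by rewrite (IHs _ u_in).
by rewrite (IHt _ u_in) /= addnS.
Qed.

Lemma all_shuffle (p : pred T) s t r :
  r \in shuffle s t -> all p r = all p s && all p t.
Proof.
move: s t r; apply: shuffle_ind => [t r|s r|a s b t IHs IHt r].
- by rewrite inE => /eqP->.
- by rewrite shuffles0 inE => /eqP->; rewrite andbT.
rewrite shuffle_cons mem_cat => /orP[] /mapP[u u_in ->] /=.
  by rewrite (IHs _ u_in) andbA.
by rewrite (IHt _ u_in) /= andbCA.
Qed.

Fixpoint splits s : seq (seq T * seq T) :=
  ([::], s) :: if s is a :: s' then [seq (a :: uv.1, uv.2) | uv <- splits s']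
               else [::].

Lemma big_splits_cons (V : nmodType) (G : seq T -> seq T -> V) a s :
  \sum_(uv <- splits (a :: s)) G uv.1 uv.2 =
  G [::] (a :: s) + \sum_(uv <- splits s) G (a :: uv.1) uv.2.
Proof. by rewrite /= big_cons big_map. Qed.

Lemma mem_splits s u v : (u, v) \in splits s -> u ++ v = s.
Proof.
elim: s u v => [|a s IHs] u v; first by rewrite inE => /eqP[-> ->].
rewrite inE => /orP[/eqP[-> ->] //|/mapP[[u' v'] /IHs <- [-> ->]]].
by [].
Qed.

(** The bialgebra property: cutting a shuffle in two amounts to cutting [s] and [t] and shuffling
    prefixes and suffixes separately. In the induction [G] absorbs the first letter. *)
Lemma sum_splits_shuffle (V : nmodType) (G : seq T -> seq T -> V) s t :
  \sum_(r <- shuffle s t) \sum_(uv <- splits r) G uv.1 uv.2 =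
  \sum_(p <- splits s) \sum_(q <- splits t)
    \sum_(u <- shuffle p.1 q.1) \sum_(v <- shuffle p.2 q.2) G u v.
Proof.
move: s t G; apply: shuffle_ind => [t G|s G|a s b t IHs IHt G].
- rewrite /= !big_seq1; apply: eq_bigr => q _.
  by rewrite /= !big_seq1.
- rewrite shuffles0 /= big_seq1; apply: eq_bigr => q _.
  by rewrite /= big_seq1 !shuffles0 !big_seq1.
pose K (F : seq T -> seq T -> V) u v u' v' :=
  \sum_(x <- shuffle u u') \sum_(y <- shuffle v v') F x y.
have KE F u v u' v' : K F (a :: u) v (b :: u') v' =
    K (fun x => F (a :: x)) u v (b :: u') v' +
    K (fun x => F (b :: x)) (a :: u) v u' v'.
  by rewrite /K shuffle_cons big_cat !big_map.
pose H F u v := \sum_(q <- splits (b :: t)) K F u v q.1 q.2.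
have HE F u v : H F u v =
    K F u v [::] (b :: t) + \sum_(q <- splits t) K F u v (b :: q.1) q.2.
  exact: big_splits_cons.
rewrite -/(K G) -[RHS]/(\sum_(p <- splits (a :: s)) H G p.1 p.2).
rewrite big_splits_cons HE shuffle_cons big_cat !big_map.
under eq_bigr do rewrite big_splits_cons.
under [X in _ + X = _]eq_bigr do rewrite big_splits_cons.
pose Kt u v := \sum_(q <- splits t) K (fun x => G (b :: x)) u v q.1 q.2.
rewrite !big_split (IHs (fun u => G (a :: u))) (IHt (fun u => G (b :: u))).
rewrite -[X in _ + X + _]/(\sum_(p <- splits s) H (fun x => G (a :: x)) p.1 p.2).
rewrite -[X in _ + (_ + X)]/(\sum_(p <- splits (a :: s)) Kt p.1 p.2).
(* The terms are matched according to which of the prefixes of [a :: s] and [b :: t] are empty. *)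
rewrite big_splits_cons addrACA -!addrA addrA; congr (_ + _).
  by rewrite /K big_seq1 shuffle_cons big_cat !big_map.
rewrite addrCA; congr (_ + _).
  by apply: eq_bigr => q _; rewrite /K /= !big_seq1.
rewrite -big_split /=; apply: eq_bigr => p _.
rewrite !HE -addrA; congr (_ + _).
  by rewrite /K !shuffles0 !big_seq1.
by rewrite -big_split /=; apply: eq_bigr => q _; rewrite KE.
Qed.

End Shuffle.

(** * Characters of the shuffle algebra and their convolution *)

Section Characters.
Variables (T : eqType) (R : comPzRingType).
Implicit Types (phi psi : seq T -> R) (e : rel T) (s t : seq T).

Definition shuffle_character phi := forall s t, ~~ has (mem s) t ->
  phi s * phi t = \sum_(r <- shuffle s t) phi r.

Definition convolution phi psi s : R :=
  \sum_(uv <- splits s) phi uv.1 * psi uv.2.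

(** Deconcatenation is multiplicative for shuffles, and commutativity of [R] regroups the
    factors. *)
Lemma convolution_character phi psi :
  shuffle_character phi -> shuffle_character psi ->
  shuffle_character (convolution phi psi).
Proof.
move=> hphi hpsi s t st; rewrite /convolution.
rewrite (sum_splits_shuffle (fun u v => phi u * psi v)) big_distrl /=.
rewrite big_seq [RHS]big_seq; apply: eq_bigr => -[u v] /mem_splits uv.
rewrite big_distrr big_seq [RHS]big_seq /=; apply: eq_bigr => -[x y] /mem_splits xy.
have [ux vy] : ~~ has (mem u) x /\ ~~ has (mem v) y.
  split; apply: contra st => /hasP[z zx zu]; apply/hasP; exists z => /=;
    by rewrite -?uv -?xy mem_cat ?zx ?(zu : z \in _) ?orbT.
rewrite /= mulrACA hphi // hpsi // big_distrl; apply: eq_bigr => r _.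
by rewrite big_distrr.
Qed.

Definition nil_char s : R := (nilp s)%:R.

Lemma nil_char_character : shuffle_character nil_char.
Proof.
move=> s t _; rewrite big_seq (eq_bigr (fun=> nil_char s * nil_char t)); last first.
  move=> r /size_shuffle sz; rewrite /nil_char /nilp sz addn_eq0.
  by case: (size s == 0%N); rewrite ?mul1r ?mul0r.
rewrite -big_seq; case: s t => [|a s] [|b t]; rewrite ?big_seq1 //.
by rewrite /nil_char /= mul0r big1.
Qed.

(** The contribution of a single alphabet letter of weight [z] that may be repeated along steps in
    [e]. *)
Definition sorted_char e z s : R := if sorted e s then z ^+ size s else 0.

Lemma sorted_char_cons e z a s : transitive e ->
  sorted_char e z (a :: s) = (all (e a) s)%:R * z * sorted_char e z s.
Proof.
move=> e_tr; rewrite /sorted_char /= path_sortedE //.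
by case: all; case: sorted; rewrite /= ?mul1r ?mul0r ?mulr0 ?exprS.
Qed.

(* If the words s and t are both sorted, exactly one of their shuffles is. *)
Lemma sorted_char_character e z : transitive e ->
  (forall a b, a != b -> e b a = ~~ e a b) ->
  shuffle_character (sorted_char e z).
Proof.
move=> e_tr e_total; apply: shuffle_ind => [t _|s _|a s b t IHs IHt].
- by rewrite big_seq1 mul1r.
- by rewrite shuffles0 big_seq1 mulr1.
case/disjoint_cons => ab ds dt.
have sum_cons c x y : \sum_(r <- map (cons c) (shuffle x y)) sorted_char e z r =
    (all (e c) x)%:R * (all (e c) y)%:R * z *
    \sum_(r <- shuffle x y) sorted_char e z r.
  rewrite big_map big_distrr /= big_seq [RHS]big_seq.
  apply: eq_bigr => r /all_shuffle ar; rewrite sorted_char_cons // ar.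
  by case: all; case: all; rewrite ?mul1r ?mul0r.
rewrite shuffle_cons big_cat !sum_cons -IHs // -IHt // !sorted_char_cons //=.
have all_head c d x : all (e d) x -> e c d -> all (e c) x.
  by move=> dx cd; apply: sub_all dx => w; apply: e_tr.
have ead := all_head a b t; have eda := all_head b a s.
rewrite (e_total _ _ ab) in eda *.
(* If [e a b], no sorted shuffle starts with [b], and the extra condition [all (e a) t] follows from
   [all (e b) t]; the other case is symmetric. *)
case eab: (e a b) ead eda => /= ead eda.
  rewrite !(mul0r, mulr0, addr0).
  case: (boolP (all (e b) t)) => [/ead->//|_].
    by rewrite ?mulr1 ?mul1r; ring.
  by rewrite !(mul0r, mulr0).
rewrite !(mul0r, mulr0, add0r).
case: (boolP (all (e a) s)) => [/eda->//|_].
  by rewrite ?mulr1 ?mul1r; ring.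
by rewrite !(mul0r, mulr0).
Qed.

Lemma convolution_sorted_nil e z phi :
  convolution (sorted_char e z) phi [::] = phi [::].
Proof. by rewrite /convolution big_seq1 mul1r. Qed.

Lemma convolution_sorted1 e z phi a :
  convolution (sorted_char e z) phi [:: a] = phi [:: a] + z * phi [::].
Proof.
by rewrite /convolution big_cons big_seq1 mul1r.
Qed.

(** The empty prefix gives the first term; otherwise [a] contributes [z], and the prefix can go on
    through [b] only if [e a b]. *)
Lemma convolution_sorted_cons e z phi a b s :
  convolution (sorted_char e z) phi [:: a, b & s] =
  phi [:: a, b & s] +
  z * (if e a b then convolution (sorted_char e z) phi (b :: s)
       else phi (b :: s)).
Proof.
rewrite /convolution (big_splits_cons (fun u v => _ u * phi v)) mul1r; congr (_ + _).
rewrite (big_splits_cons (fun u v => sorted_char e z (a :: u) * phi v)).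
rewrite (big_splits_cons (fun u v => _ u * phi v)) mul1r.
rewrite {1}/sorted_char /= expr1.
case: ifP => eab; last first.
  by rewrite big1 ?addr0 // => u _; rewrite /sorted_char /= eab mul0r.
rewrite mulrDr big_distrr; congr (_ + _); apply: eq_bigr => u _.
rewrite /sorted_char /= eab /=; case: path; rewrite ?mul0r ?mulr0 //.
by rewrite exprS mulrA.
Qed.
End Characters.

(** * Recursive forms of the descent and left peak numbers *)

Section Statistics.
Implicit Types (d : bool) (a b x : nat) (s : seq nat).

(** For distinct letters [<=] agrees with [<], and it makes descents the exact complement of
    [ltn]. *)
Definition head_descent a s : bool := if s is b :: _ then (b <= a)%N else false.

Fixpoint word_des s : nat :=
  if s is a :: s' then (head_descent a s' + word_des s')%N else 0%N.

(* The number of left peaks of [s]; [d] tells whether the first letter is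
   preceded by a larger one. *)
Fixpoint word_lpk d s : nat :=
  if s is a :: s' then
    ((~~ d && head_descent a s') + word_lpk (head_descent a s') s')%N
  else 0%N.

Lemma word_desE s : uniq s ->
  count (fun i => nth 0%N s i > nth 0%N s i.+1)%N (iota 0 (size s).-1) =
  word_des s.
Proof.
elim: s => [|a [|b s] IHs] // /andP[]; rewrite inE negb_or => /andP[ab _] us.
rewrite -[RHS]/((b <= a) + word_des (b :: s))%N -IHs //=.
by rewrite (leq_eqVlt b) eq_sym (negbTE ab) (iotaDl 1 0) count_map.
Qed.

Lemma word_lpkE x s : uniq (x :: s) ->
  count (fun i => (nth 0 (x :: s) i < nth 0 (x :: s) i.+1) &&
                  (nth 0 (x :: s) i.+1 > nth 0 (x :: s) i.+2))%N
    (iota 0 (size s).-1) = word_lpk (head_descent x s) s.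
Proof.
elim: s x => [|a [|b s] IHs] x //; first by rewrite /= andbF.
move=> /andP[_ uas]; have /andP[] := uas; rewrite inE negb_or => /andP[ab _] _.
rewrite -[RHS]/((~~ (a <= x) && (b <= a)) +
  word_lpk (head_descent a (b :: s)) (b :: s))%N -(IHs a uas) /=.
by rewrite -ltnNge (leq_eqVlt b) eq_sym (negbTE ab) (iotaDl 1 0) count_map.
Qed.

Lemma desE p : des p = word_des (val p).
Proof.
have /andP[up _] := valP p; rewrite -word_desE // /des (iotaDl 1 0) count_map.
by [].
Qed.

Lemma lpkE p : lpk p = word_lpk false (val p).
Proof.
have /andP[up p0] := valP p.
(* A letter 0 put in front lies below all others and turns a left peak at index 1 into an ordinary
   peak. *)
have -> : false = head_descent 0 (val p).
  case: (val p) p0 => [|a s] //; rewrite inE negb_or eq_sym => /andP[a0 _].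
  by rewrite /= leqn0 (negbTE a0).
rewrite -word_lpkE /= ?p0 // /lpk (iotaDl 1 0) count_map /len.
apply: eq_in_count => i; rewrite mem_iota add0n /= => ip.
rewrite /is_left_peak /is_peak /letter /len /= add1n.
case: i ip => [|i] ip /=; last by rewrite ip orbF.
rewrite lt0n; case: eqP => // n0; case/negP: p0.
have : nth 0%N (val p) 0 \in val p by apply: mem_nth; case: size ip => [|[]].
by rewrite n0.
Qed.

(** Each left peak starts a maximal run of descents, and a run of r descents occupies r + 1 letters.
    The bounds keep the truncated subtractions in [gf_closed] exact; if [d] holds, [s] must contain
    the lower end of the pending descent. *)
Lemma word_stat_bound d s : (d ==> (s != [::])) ->
  (word_lpk d s <= word_des s)%N && (d + word_lpk d s + word_des s <= size s)%N.
Proof.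
elim: s d => [|a s IHs] [] //= _; have := IHs (head_descent a s);
  case: s {IHs} => [|b s]; rewrite /= ?leqnn //;
  by case: (b <= a)%N => /(_ isT) /=; lia.
Qed.

End Statistics.

(** * The transfer-matrix generating function and its closed form *)

Section GeneratingFunction.
Implicit Types (d : bool) (a b : nat) (s w : seq nat).
Local Notation T := (fps_t%:P : {poly fps}).
Local Notation J := (((1 - fps_t)^-1)%:P : {poly fps}).

Lemma J_geometric : J * (1 - T) = 1.
Proof. by rewrite -polyCB -polyCM mulVr // unit_1Bt. Qed.

(* The entries of the two rank-one transfer matrices: [d] and [d'] tell
   whether the steps before and after a letter are descents. *)
Definition step_weight d d' : {poly fps} :=
  match d, d' with
  | false, false => 1 + 'X * T
  | false, true => T * (1 + 'X)
  | true, false => 1 + 'X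
  | true, true => 'X + T
  end.

(** [gf false s] will be the sum of t^m F_m(s), and [gf true s] the same sum with one more odd
    letter below e_0. The last letter counts as followed by an ascent. *)
Fixpoint gf d s : {poly fps} :=
  if s is a :: s' then
    step_weight d (head_descent a s') * J * gf (head_descent a s') s'
  else J.

(** Left peaks give t(1+y), ends of descent runs 1+y, double descents y+t, and other letters 1+yt.
    Run ends are as many as left peaks, plus one if [d] holds. *)
Lemma gf_closed d s : (d ==> (s != [::])) ->
  gf d s = T ^+ word_lpk d s * ('X + T) ^+ (word_des s - word_lpk d s)
    * (1 + 'X * T) ^+ (size s - d - word_lpk d s - word_des s)
    * (1 + 'X) ^+ (2 * word_lpk d s + d) * J ^+ (size s).+1.
Proof.
pose F L u v k n : {poly fps} :=
  T ^+ L * ('X + T) ^+ u * (1 + 'X * T) ^+ v * (1 + 'X) ^+ k * J ^+ n.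
elim: s d => [|a s IHs] d ds; first by case: d ds => //= _; rewrite !expr0 !mul1r.
have d's : head_descent a s ==> (s != [::]) by case: (s) => //= ? ?; rewrite implybT.
have := word_stat_bound d's; rewrite [LHS]/= (IHs _ d's) /=.
move: (head_descent a s) (word_lpk _ s) (word_des s) (size s).
move=> d' L D n /andP[LD Ln].
rewrite -[X in _ * X = _]/(F _ _ _ _ _) -[RHS]/(F _ _ _ _ _).
have [u uE] : {u | D - L = u}%N by exists (D - L)%N.
have [v vE] : {v | n - d' - L - D = v}%N by exists (n - d' - L - D)%N.
have FE L0 u0 v0 k0 n0 L1 u1 v1 k1 n1 : (L0 = L1)%N -> (u0 = u1)%N ->
    (v0 = v1)%N -> (k0 = k1)%N -> (n0 = n1)%N -> F L0 u0 v0 k0 n0 = F L1 u1 v1 k1 n1.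
  by move=> -> -> -> -> ->.
rewrite uE vE; case: d d' LD Ln vE {ds d's IHs} => [] [] /= LD Ln vE.
- rewrite [RHS](FE _ _ _ _ _ L u.+1 v (2 * L).+1 n.+2); try lia.
  by rewrite /F addn1 !exprS; ring.
- rewrite [RHS](FE _ _ _ _ _ L u v (2 * L).+1 n.+2); try lia.
  by rewrite /F addn0 !exprS; ring.
- rewrite [RHS](FE _ _ _ _ _ L.+1 u v (2 * L).+2 n.+2); try lia.
  by rewrite /F addn1 !exprS; ring.
rewrite [RHS](FE _ _ _ _ _ L u v.+1 (2 * L)%N n.+2); try lia.
by rewrite /F addn0 !exprS; ring.
Qed.

(** Reduces identities modulo J(1-T) = 1 to plain ring identities; [A] is the cofactor of this
    relation. *)
Lemma J_cancel (A x y : {poly fps}) : x - y = A * (J * (1 - T) - 1) -> x = y.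
Proof.
by move=> xy; apply/eqP; rewrite -subr_eq0 xy J_geometric subrr mulr0.
Qed.

(** Here begin the recurrences of convolution with [sorted_char], summed over m: [gf false] adds a
    lowest even letter to [T * gf true], where T shifts m, and [gf true] adds a lowest odd letter to
    [gf false]. *)
Lemma gf_false_nil : gf false [::] = 1 + T * gf true [::].
Proof. by apply: (J_cancel (A := 1)); rewrite /=; ring. Qed.

Lemma gf_false1 a : gf false [:: a] = T * gf true [:: a] + gf false [::].
Proof. by apply: (J_cancel (A := J)); rewrite /=; ring. Qed.

Lemma gf_true1 a : gf true [:: a] = gf false [:: a] + 'X * gf false [::].
Proof. by apply: (J_cancel (A := 'X * J)); rewrite /=; ring. Qed.

Lemma gf_cons2 d a b s : gf d [:: a, b & s] =
  step_weight d (b <= a)%N * J * gf (b <= a)%N (b :: s).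
Proof. by []. Qed.

Lemma gf_false_cons a b s : gf false [:: a, b & s] = T * gf true [:: a, b & s] +
  (if (a < b)%N then gf false (b :: s) else T * gf true (b :: s)).
Proof.
rewrite !gf_cons2; move: (b :: s) => w; case: leqP => _ /=.
  by apply: (J_cancel (A := T * gf true w)); ring.
by apply: (J_cancel (A := gf false w)); ring.
Qed.

Lemma gf_true_cons a b s : gf true [:: a, b & s] = gf false [:: a, b & s] +
  'X * (if (b <= a)%N then gf true (b :: s) else gf false (b :: s)).
Proof.
rewrite !gf_cons2; move: (b :: s) => w; case: leqP => _ /=.
  by apply: (J_cancel (A := 'X * gf true w)); ring.
by apply: (J_cancel (A := 'X * gf false w)); ring.
Qed.

End GeneratingFunction.

(** * Coefficients of t^m as characters *)

Section Coefficients.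
Implicit Types (m n : nat) (s w : seq nat).

Definition fps_coef n (f : fps) : rat := fcoef f n.

Lemma fps_coef_is_zmod_morphism n : zmod_morphism (fps_coef n).
Proof. by []. Qed.

HB.instance Definition _ n :=
  GRing.isZmodMorphism.Build fps rat (fps_coef n) (fps_coef_is_zmod_morphism n).

Definition tcoef n : {poly fps} -> {poly rat} := map_poly (fps_coef n).

Lemma tcoefD n : {morph tcoef n : P Q / P + Q}.
Proof. exact: raddfD. Qed.

Lemma coef_tcoef n P i : (tcoef n P)`_i = fcoef P`_i n.
Proof. by rewrite coef_map. Qed.

Lemma fps_mulTE f n : fcoef (fps_t * f) n = if n is n'.+1 then fcoef f n' else 0.
Proof.
rewrite mulrC /=; case: n => [|n] /=; first by rewrite big_ord1 mulr0.
rewrite !big_ord_recr /= subnn mulr0 addr0 subSnn mulr1 big1 ?add0r // => i _.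
by case: eqP => [|_]; rewrite ?mulr0 //; have := ltn_ord i; lia.
Qed.

Lemma tcoefT n P :
  tcoef n (fps_t%:P * P) = if n is n'.+1 then tcoef n' P else 0.
Proof.
apply/polyP => i; rewrite coef_tcoef coefCM fps_mulTE.
by case: n => [|n]; rewrite ?coef0 ?coef_tcoef.
Qed.

Lemma tcoefX n P : tcoef n ('X * P) = 'X * tcoef n P.
Proof.
by apply/polyP => i; rewrite coef_tcoef !coefXM; case: eqP; rewrite ?coef_tcoef.
Qed.

Lemma tcoef1 n : tcoef n 1 = (n == 0%N)%:R.
Proof.
apply/polyP => i; rewrite coef_tcoef -[1]/(1%:P) coefC.
by case: i n => [|i] [|n]; rewrite ?coef1 ?coef0.
Qed.

Definition even_char : seq nat -> {poly rat} := sorted_char ltn 1.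
Definition odd_char : seq nat -> {poly rat} := sorted_char geq 'X.

(* Evaluates the fundamental function of a word, weighting odd letters by y, on the
   super-alphabet e_0 < o_1 < e_1 < ... < o_m < e_m; in a weakly increasing
   sequence of letters e_i may be repeated at ascents and o_i at descents. *)
Fixpoint alphabet_char m : seq nat -> {poly rat} :=
  convolution even_char
    (if m is m'.+1 then convolution odd_char (alphabet_char m') else nil_char _).

Lemma even_char_character : shuffle_character even_char.
Proof.
apply: sorted_char_character => [|a b ab]; first exact: ltn_trans.
by rewrite /= [(b < a)%N]ltnNge leq_eqVlt (negbTE ab).
Qed.

Lemma odd_char_character : shuffle_character odd_char.
Proof.
apply: sorted_char_character => [b a c ab bc|a b ab]; first exact: leq_trans bc ab.
by rewrite /= -ltnNge ltn_neqAle ab.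
Qed.

Lemma alphabet_char_character m : shuffle_character (alphabet_char m).
Proof.
elim: m => [|m IHm]; apply: convolution_character; try exact: even_char_character.
  exact: nil_char_character.
by apply: convolution_character => //; apply: odd_char_character.
Qed.

(** The recurrence on words determines the convolution, so a candidate has only to satisfy it. *)
Lemma convolution_sorted_unique (e : rel nat) (z : {poly rat})
    (phi psi : seq nat -> {poly rat}) :
  psi [::] = phi [::] ->
  (forall a, psi [:: a] = phi [:: a] + z * phi [::]) ->
  (forall a b s, psi [:: a, b & s] = phi [:: a, b & s] +
     z * (if e a b then psi (b :: s) else phi (b :: s))) ->
  psi =1 convolution (sorted_char e z) phi.
Proof.
move=> psi0 psi1 psi2; elim=> [|a [|b s] IHs].
- by rewrite convolution_sorted_nil.
- by rewrite convolution_sorted1.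
by rewrite convolution_sorted_cons psi2 IHs.
Qed.

Lemma tcoef_gf m s : tcoef m (gf false s) = alphabet_char m s.
Proof.
elim: m s => [|m IHm].
  (* In degree 0 multiples of t vanish, as [nil_char] does on nonempty words. *)
  apply: convolution_sorted_unique => [|a|a b s].
  - by rewrite gf_false_nil tcoefD tcoefT tcoef1 addr0.
  - by rewrite gf_false1 gf_false_nil !tcoefD !tcoefT tcoef1 mul1r addr0.
  by rewrite gf_false_cons tcoefD tcoefT mul1r (fun_if (tcoef 0)) tcoefT.
(* Degree m of [gf true] has an extra odd letter at the bottom; the factor t then moves it to degree
   m + 1, where an even letter is added. *)
have IHtrue w : tcoef m (gf true w) = convolution odd_char (alphabet_char m) w.
  move: w; apply: convolution_sorted_unique => [|a|a b s].
  - by rewrite -IHm.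
  - by rewrite gf_true1 tcoefD tcoefX !IHm.
  by rewrite gf_true_cons tcoefD tcoefX (fun_if (tcoef m)) !IHm.
apply: convolution_sorted_unique => [|a|a b s].
- by rewrite gf_false_nil tcoefD tcoefT tcoef1 add0r -IHtrue.
- by rewrite gf_false1 gf_false_nil !tcoefD !tcoefT tcoef1 mul1r add0r -!IHtrue.
by rewrite gf_false_cons tcoefD tcoefT mul1r (fun_if (tcoef _)) tcoefT -!IHtrue.
Qed.

End Coefficients.

(** * Images under the Hadamard product and their multiplicativity *)

Section Hadamard.
Implicit Types (p q : permutation) (P Q : {poly fps}) (j k n m : nat).
Local Notation T := (fps_t%:P : {poly fps}).
Local Notation J := (((1 - fps_t)^-1)%:P : {poly fps}).

Definition hadamard_y : {poly fps} -> {poly hps} :=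
  map_poly (fun f : fps => Hps (fcoef f)).

Lemma coef_hadamard_y P i : (hadamard_y P)`_i = Hps (fcoef P`_i).
Proof. exact: coef_map_id0. Qed.

Lemma hadamardE P n : hadamard (P%:P * 'X^n) = (hadamard_y P)%:P * 'X^n.
Proof.
apply/polyP => i; rewrite coef_map_id0.
  rewrite !coefCM !coefXn; case: eqP => _; rewrite ?mulr1 ?mulr0 //.
  by apply/polyP => l; rewrite coef_hadamard_y !coef0.
by apply/polyP => l; rewrite coef_hadamard_y !coef0.
Qed.

Definition term_y j k n : {poly fps} :=
  T ^+ j * ('X + T) ^+ (k - j) * (1 + 'X * T) ^+ (n - j - k)
    * (1 + 'X) ^+ (2 * j) * J ^+ n.+1.

Lemma lpkdes_termE j k n :
  lpkdes_term j k n = (hadamard_y (term_y j k n))%:P * 'X^n.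
Proof.
rewrite -hadamardE /lpkdes_term /var_x /term_y; congr (hadamard (_ * _)).
by rewrite !rmorphM !rmorphXn !rmorphD !rmorphM /= /over_1Bt -exprVn !rmorphXn.
Qed.

Lemma unit_eltE : unit_elt = lpkdes_term 0 0 0.
Proof. by rewrite /lpkdes_term !mul1r mulr1. Qed.

Lemma lpkdes_imageE p : lpkdes_image p = lpkdes_term (lpk p) (des p) (len p).
Proof.
rewrite /lpkdes_image; case: ltnP => //; rewrite leqn0 => /eqP p0.
by rewrite unit_eltE lpkE desE p0; move: p0; rewrite /len; case: (val p).
Qed.

Lemma lpkdes_image_gf p :
  lpkdes_image p = (hadamard_y (gf false (val p)))%:P * 'X^(len p).
Proof.
by rewrite lpkdes_imageE lpkdes_termE gf_closed // lpkE desE subn0 addn0.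
Qed.

Lemma hcoef_sum (I : Type) (r : seq I) (F : I -> hps) m :
  hcoef (\sum_(i <- r) F i) m = \sum_(i <- r) hcoef (F i) m.
Proof. by apply: (big_morph (fun f => hcoef f m)). Qed.

(** The Hadamard product acts coefficientwise in t, so for each m only an ordinary product of
    polynomials in y is involved. *)
Lemma hadamard_yM (I : Type) (r : seq I) (F : I -> {poly fps}) P Q :
  (forall m, tcoef m P * tcoef m Q = \sum_(i <- r) tcoef m (F i)) ->
  hadamard_y P * hadamard_y Q = \sum_(i <- r) hadamard_y (F i).
Proof.
move=> PQ; apply/polyP => i; apply: hpsP => m.
have := congr1 (fun p : {poly rat} => p`_i) (PQ m).
rewrite !coefM !coef_sum !hcoef_sum => PQi.
under [RHS]eq_bigr do rewrite coef_hadamard_y /= -coef_tcoef.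
rewrite -PQi; apply: eq_bigr => l _.
by rewrite /= !coef_hadamard_y !coef_tcoef.
Qed.

Lemma gf_shuffle s t : ~~ has (mem s) t ->
  hadamard_y (gf false s) * hadamard_y (gf false t) =
  \sum_(r <- shuffle s t) hadamard_y (gf false r).
Proof.
move=> st; apply: hadamard_yM => m; under eq_bigr do rewrite tcoef_gf.
by rewrite !tcoef_gf; apply: alphabet_char_character.
Qed.

Lemma perm_shuffles p q : disjoint_perm p q ->
  perm_eq (map val (shuffles p q)) (shuffle (val p) (val q)).
Proof.
move=> pq; have /andP[up p0] := valP p; have /andP[uq q0] := valP q.
have upq : uniq (val p ++ val q) by rewrite cat_uniq up uq andbT.
apply: uniq_perm; first by rewrite (map_inj_uniq val_inj) shuffles_uniq.
  exact: shuffle_uniq.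
move=> r; rewrite mem_shuffle //; apply/mapP/and3P => [[x + ->]|[pr sp sq]].
  rewrite /shuffles mem_pmap_sub mem_filter mem_permutations.
  by move=> /andP[/andP[]].
have vr : uniq r && (0%N \notin r).
  by rewrite (perm_uniq pr) upq (perm_mem pr) mem_cat negb_or p0.
exists (Sub r vr); last by rewrite SubK.
by rewrite /shuffles mem_pmap_sub mem_filter mem_permutations SubK pr sp sq.
Qed.

Lemma lpkdes_image_shuffles p q : disjoint_perm p q ->
  lpkdes_image p * lpkdes_image q = \sum_(r <- shuffles p q) lpkdes_image r.
Proof.
move=> pq; rewrite !lpkdes_image_gf mulrACA -polyCM -exprD gf_shuffle //.
rewrite rmorph_sum /= big_distrl /= -(perm_big _ (perm_shuffles pq)) big_map.
rewrite big_seq [RHS]big_seq; apply: eq_bigr => r /len_shuffles lr.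
by rewrite lpkdes_image_gf lr.
Qed.

End Hadamard.

(** * Linear independence of the images *)

Section Independence.
Implicit Types (j k n : nat).

(** These are exactly the pairs attained in length [n], by [valid_stat_lpkdes] and [lpkdes_realize];
    the last condition reflects that the first descent of a word occurs at a left peak. *)
Definition valid_stat n (jk : nat * nat) : bool :=
  [&& (jk.1 <= jk.2)%N, (jk.1 + jk.2 <= n)%N & (jk.1 == 0%N) ==> (jk.2 == 0%N)].

(** Reads the lowest monomial of [lpkdes_term j k n], with powers of t compared before powers of
    y. *)
Definition corner_coef j k n (P : hpoly) : rat := hcoef P`_n`_(k - j) j.

Lemma fps_coef0_is_monoid_morphism : monoid_morphism (fps_coef 0).
Proof. by split=> // f g; rewrite /fps_coef /= big_ord1. Qed.

HB.instance Definition _ := GRing.isMonoidMorphism.Build fps rat (fps_coef 0)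
  fps_coef0_is_monoid_morphism.

Lemma tcoefTn m j P :
  tcoef m (fps_t%:P ^+ j * P) = if (m < j)%N then 0 else tcoef (m - j) P.
Proof.
elim: j m => [|j IHj] m; first by rewrite mul1r subn0.
by rewrite exprS -mulrA tcoefT; case: m => // m; rewrite IHj.
Qed.

Lemma tcoef0_term j k n : tcoef 0 (('X + fps_t%:P) ^+ (k - j)
    * (1 + 'X * fps_t%:P) ^+ (n - j - k) * (1 + 'X) ^+ (2 * j)
    * ((1 - fps_t)^-1)%:P ^+ n.+1) = 'X ^+ (k - j) * (1 + 'X) ^+ (2 * j).
Proof.
rewrite /tcoef !rmorphM !rmorphXn !rmorphD /= rmorphM /= !map_polyX !map_polyC /=.
rewrite inv_1Bt /fps_coef /= polyC0 polyC1.
by rewrite !mulr0 !addr0 !expr1n !mulr1.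
Qed.

(* Lexicographic triangularity: this coefficient separates the generators. *)
Lemma corner_coef_term j k n j' k' n' : (j <= k)%N -> (j' <= k')%N ->
  ((n == n') ==> (j < j') || (j == j') && (k <= k'))%N ->
  corner_coef j k n (lpkdes_term j' k' n') = ((n, (j, k)) == (n', (j', k')))%:R.
Proof.
move=> jk jk' lex; rewrite /corner_coef lpkdes_termE coefCM coefXn !xpair_eqE.
case: eqP lex => [_|_ _]; last by rewrite mulr0 coef0.
rewrite mulr1 coef_hadamard_y /= /term_y -!(mulrA (_ ^+ j')) -coef_tcoef tcoefTn.
move=> /orP[jj|/andP[/eqP<- kk]].
  by rewrite jj coef0 ltn_eqF.
rewrite ltnn subnn eqxx tcoef0_term coefXnM.
(* For equal [k] the constant term of (1+y)^(2j) remains; a larger [k'] makes the power of y too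
   high. *)
have [->|kk'] := eqVneq k k'.
  by rewrite ltnn subnn -horner_coef0 !hornerE expr1n.
by rewrite ifT //; move: kk kk'; lia.
Qed.

(** Strong induction on j, then k: the corner coefficient at (n, j, k) kills the lexicographically
    larger terms, and the smaller ones already have coefficient zero. A general [key] serves
    statistics, classes and basis indices alike. *)
Lemma lpkdes_term_free (I : eqType) (r : seq I) (key : I -> nat * (nat * nat))
    (c : I -> rat) :
  uniq r -> {in r &, injective key} ->
  {in r, forall i, ((key i).2.1 <= (key i).2.2)%N} ->
  \sum_(i <- r) c i *: lpkdes_term (key i).2.1 (key i).2.2 (key i).1 = 0 ->
  {in r, forall i, c i = 0}.
Proof.
move=> ur key_inj key_le sum0.
suff c0 n j k : {in r, forall i, key i = (n, (j, k)) -> c i = 0}.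
  by move=> i ir; case ki: (key i) => [n [j k]]; apply: (c0 n j k).
elim/ltn_ind: j k => j IHj; elim/ltn_ind => k IHk i ir ki.
have jk := key_le i ir; rewrite ki /= in jk.
have := congr1 (corner_coef j k n) sum0.
have ccD : {morph corner_coef j k n : P Q / P + Q}.
  by move=> P Q; rewrite /corner_coef !coefD.
have cc0 : corner_coef j k n 0 = 0 by rewrite /corner_coef !coef0.
have ccZ a P : corner_coef j k n (a *: P) = a * corner_coef j k n P.
  by rewrite /corner_coef -[a *: P]/(hconst a * P) !coefCM.
rewrite (big_morph _ ccD cc0) (bigD1_seq i) //= cc0 ccZ ki /=.
rewrite corner_coef_term ?leqnn ?eqxx ?orbT ?implybT // mulr1.
rewrite big_seq_cond big1 ?addr0 // => i' /andP[i'r i'i]; rewrite ccZ.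
case ki' : (key i') => [n' [j' k']] /=.
have j'k' := key_le i' i'r; rewrite ki' /= in j'k'.
have [lex|] := boolP ((n == n') ==> (j < j') || (j == j') && (k <= k'))%N.
  rewrite corner_coef_term //; case: eqP => [kk|]; rewrite ?mulr0 //.
  by case/eqP: i'i; apply: key_inj => //; rewrite ki ki' kk.
rewrite negb_imply negb_or => /andP[/eqP nn /andP[jj kk]].
suff -> : c i' = 0 by rewrite mul0r.
rewrite -nn in ki'.
have [jj'|jj'] := ltnP j' j; first exact: (IHj _ jj' k' i' i'r ki').
have ejj : j' = j by move: jj jj'; lia.
rewrite ejj in ki'; apply: (IHk k' _ i' i'r ki').
by move: kk; rewrite ejj eqxx; lia.
Qed.

End Independence.

(** * Attained pairs, disjoint copies, and the count of pairs *)

Section Realization.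
Implicit Types (w : seq nat) (p q : permutation) (N n j k : nat).

Lemma word_lpk_eq0 w : word_lpk false w = 0%N -> word_des w = 0%N.
Proof.
elim: w => [|a w IHw] //=; case: (head_descent a w) => //=.
Qed.

Lemma valid_stat_lpkdes p : valid_stat (len p) (lpkdes p).
Proof.
rewrite /valid_stat /lpkdes /= lpkE desE.
have /andP[-> ->] := @word_stat_bound false (val p) isT.
by apply/implyP => /eqP/word_lpk_eq0 ->.
Qed.

(** Words are built by prepending, and the bound [N] leaves room for smaller letters. *)
Definition realizes N n j k w : Prop :=
  [/\ uniq w, all (ltn N) w, size w = n & word_lpk false w = j /\ word_des w = k].

(** A minimum in front adds an ascent, and a left peak in first position becomes an ordinary
    peak. *)
Lemma realizes_min N n j k w :
  realizes N.+1 n j k w -> realizes N n.+1 j k (N.+1 :: w).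
Proof.
case=> uw aw <- [<- <-].
have hw : head_descent N.+1 w = false.
  by case: w aw {uw} => //= b w /andP[Nb _]; rewrite leqNgt Nb.
split; rewrite /= ?hw ?uw ?ltnSn ?andbT //.
  by apply: contraT => /negPn/(allP aw) /=; rewrite ltnn.
by apply: sub_all aw => x /=; apply: ltn_trans.
Qed.

Definition letter_above N w : nat := (N + \max_(x <- w) x).+1.

Lemma leq_letter_above N w x : x \in w -> (N + x < letter_above N w)%N.
Proof. by move=> xw; rewrite ltnS leq_add2l (@leq_bigmax_seq _ w xpredT id). Qed.

Lemma uniq_above N w : uniq w -> uniq (letter_above N w :: w).
Proof.
move=> uw; rewrite /= uw andbT; apply/negP => wi.
by have := leq_letter_above N wi; lia.
Qed.

Lemma head_descent_above N b w : head_descent (letter_above N (b :: w)) (b :: w).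
Proof.
by have := leq_letter_above N (mem_head b w); rewrite /=; lia.
Qed.

(** A maximum before an initial descent adds a descent, while the left peak at the first letter
    moves to the new letter. *)
Lemma realizes_above N n j k a w : head_descent a w ->
  realizes N n j k (a :: w) ->
  realizes N n.+1 j k.+1 (letter_above N (a :: w) :: a :: w).
Proof.
move=> ha [uw aw <- [<- <-]].
split; first exact: uniq_above.
- by rewrite /= in aw *; rewrite aw andbT /letter_above; lia.
- by [].
have := head_descent_above N a w; move: (letter_above _ _) => b hb.
rewrite -[word_lpk false _]/((head_descent b (a :: w)) +
  word_lpk (head_descent b (a :: w)) (a :: w))%N.
by rewrite -[word_des (b :: _)]/(head_descent b (a :: w) + word_des (a :: w))%N
  hb /= ha.
Qed.

Lemma realizes_peak N n j k w : realizes N.+1 n j k w ->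
  realizes N n.+2 j.+1 k.+1 (letter_above N (N.+1 :: w) :: N.+1 :: w).
Proof.
move=> /[dup] [[_ aw _ _]] /realizes_min[uw aw' <- [<- <-]].
have hw : head_descent N.+1 w = false.
  by case: w aw {uw aw'} => //= b w /andP[Nb _]; rewrite leqNgt Nb.
split; first exact: uniq_above.
- by rewrite /= in aw' *; rewrite aw' andbT /letter_above; lia.
- by [].
have := head_descent_above N N.+1 w; move: (letter_above _ _) => b hb.
rewrite -[word_lpk false (b :: _)]/((head_descent b (N.+1 :: w)) +
  word_lpk (head_descent b (N.+1 :: w)) (N.+1 :: w))%N.
by rewrite -[word_des (b :: _)]/(head_descent b (N.+1 :: w) + word_des (N.+1 :: w))%N
  hb /= hw.
Qed.

(** Built from the right: j blocks of a maximum and a minimum, then k - j maxima lengthening the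
    initial descent, then n - j - k minima. *)
Lemma realizes_valid n jk : valid_stat n jk -> forall N, exists w, realizes N n jk.1 jk.2 w.
Proof.
case: jk => j k /and3P[/= jk jkn j0].
have add_min m : (j + k <= m)%N -> (forall N, exists w, realizes N (j + k) j k w) ->
    forall N, exists w, realizes N m j k w.
  move=> /subnK <- base; elim: (m - _)%N => //= i IHi N.
  by have [w /realizes_min rw] := IHi N.+1; exists (N.+1 :: w).
apply: add_min => //; case: j j0 jk {jkn} => [/eqP-> _ N|j _ jk].
  by exists [::].
have alt i : forall N, exists w, realizes N (2 * i) i i w.
  elim: i => [|i IHi] N; first by exists [::].
  have [w /realizes_peak rw] := IHi N.+1; exists (letter_above N (N.+1 :: w) :: N.+1 :: w).
  by rewrite mulnS.
suff desc i N : exists a w, head_descent a w /\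
    realizes N (2 * j.+1 + i) j.+1 (j.+1 + i) (a :: w).
  move=> N; have [a [w [_ rw]]] := desc (k - j.+1)%N N; exists (a :: w).
  by rewrite (_ : j.+1 + k = 2 * j.+1 + (k - j.+1))%N; [rewrite subnKC in rw|lia].
elim: i => [|i [a [w [ha rw]]]].
  have [w /realizes_peak rw] := alt j N.+1.
  exists (letter_above N (N.+1 :: w)), (N.+1 :: w); split.
    exact: head_descent_above.
  by rewrite !addn0 mulnS.
exists (letter_above N (a :: w)), (a :: w); split; first exact: head_descent_above.
by rewrite !addnS; apply: realizes_above.
Qed.

Lemma lpkdes_realize n jk : valid_stat n jk ->
  exists p, len p = n /\ lpkdes p = jk.
Proof.
move=> /realizes_valid/(_ 0%N)[w [uw aw szw [lw dw]]].
have w0 : uniq w && (0%N \notin w) by rewrite uw; apply/negP => /(allP aw).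
exists (Sub w w0); rewrite /len /lpkdes lpkE desE SubK.
by rewrite lw dw -surjective_pairing.
Qed.

Lemma word_des_shift N w : word_des (map (addn N) w) = word_des w.
Proof.
elim: w => [|a w IHw] //=; rewrite IHw; congr (_ + _)%N.
by case: w {IHw} => //= b w; rewrite leq_add2l.
Qed.

Lemma word_lpk_shift N d w : word_lpk d (map (addn N) w) = word_lpk d w.
Proof.
elim: w d => [|a w IHw] d //=.
have -> : head_descent (N + a) (map (addn N) w) = head_descent a w.
  by case: w {IHw} => //= b w; rewrite leq_add2l.
by rewrite IHw.
Qed.

(** Shifting the letters of [q] past the largest letter of [p] preserves their relative order. *)
Lemma disjoint_copy p q : exists q',
  [/\ disjoint_perm p q', len q' = len q & lpkdes q' = lpkdes q].
Proof.
pose N := letter_above 0 (val p); have /andP[uq q0] := valP q.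
have uq' : uniq (map (addn N) (val q)) && (0%N \notin map (addn N) (val q)).
  rewrite map_inj_uniq ?uq; last exact: addnI.
  by apply: contra q0 => /mapP[x xq]; case: x xq => //; lia.
exists (Sub (map (addn N) (val q)) uq'); split; last 2 first.
- by rewrite /len SubK size_map.
- by rewrite /lpkdes !lpkE !desE SubK word_lpk_shift word_des_shift.
rewrite /disjoint_perm SubK; apply/hasPn => _ /mapP[x xq ->] /=.
apply/negP => xp; have := leq_letter_above 0 xp; rewrite -/N; lia.
Qed.

Definition pos_stats n : seq (nat * nat) :=
  [seq (j, k) | j <- iota 1 n./2, k <- iota j (n - 2 * j).+1].

Definition valid_stats n : seq (nat * nat) := (0, 0)%N :: pos_stats n.

Lemma mem_pos_stats n j k :
  ((j, k) \in pos_stats n) = [&& 0 < j, j <= k & j + k <= n]%N.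
Proof.
apply/allpairsPdep/and3P => [[j' [k' []]]|[j0 jk jkn]].
  by rewrite !mem_iota => + + [-> ->]; split; lia.
by exists j, k; split=> //; rewrite mem_iota; lia.
Qed.

Lemma mem_valid_stats n jk : (jk \in valid_stats n) = valid_stat n jk.
Proof.
case: jk => j k; rewrite inE mem_pos_stats /valid_stat xpair_eqE /=; lia.
Qed.

Lemma uniq_valid_stats n : uniq (valid_stats n).
Proof.
rewrite cons_uniq mem_pos_stats /=; apply: allpairs_uniq_dep.
- exact: iota_uniq.
- by move=> *; apply: iota_uniq.
by move=> [a b] [c d] _ _ [-> ->].
Qed.

Lemma size_valid_stats n : size (valid_stats n) = (n ^ 2 %/ 4).+1.
Proof.
rewrite [size _]/= size_allpairs_dep; congr _.+1.
(* The summand for j is n - 2j + 1, and these add up to h(n - h). *)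
have sumE h : (h <= n./2)%N ->
    sumn [seq size (iota j (n - 2 * j).+1) | j <- iota 1 h] = (h * (n - h))%N.
  elim: h => [|h IHh] hn //; rewrite -(addn1 h) iotaD map_cat sumn_cat IHh; last by lia.
  by rewrite /= size_iota; nia.
rewrite sumE //; have := odd_double_half n.
rewrite addnC -muln2; move: (odd n) n./2 {sumE} => b h <-.
have -> : (h * (h * 2 + b - h) = h * h + h * b)%N by nia.
(* Here [b] is the parity of n, so it equals its square and is the remainder modulo 4. *)
have -> : ((h * 2 + b) ^ 2 = (h * h + h * b) * 4 + b)%N by rewrite -mulnn; case: b; nia.
by rewrite divnMDl // divn_small ?addn0 //; case: b.
Qed.

End Realization.

(** * Shuffle-compatibility, the isomorphism and the dimension *)

Section Isomorphism.
Local Open Scope classical_set_scope.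
Local Open Scope quotient_scope.
Implicit Types (p q r : permutation).

Lemma sum_count_mem (I : eqType) (V : lmodType rat) (F : I -> V) (U A : seq I) :
  uniq U -> {subset A <= U} ->
  \sum_(x <- A) F x = \sum_(x <- U) (count_mem x A)%:R *: F x.
Proof.
move=> uU; elim: A => [|a A IHA] AU.
  by rewrite big_nil big1 // => x _; rewrite scale0r.
rewrite big_cons IHA => [|x xA]; last by apply: AU; rewrite inE xA orbT.
have aU : a \in U by apply: AU; rewrite mem_head.
rewrite [F a](_ : _ = \sum_(x <- U) (a == x)%:R *: F x); last first.
  rewrite (bigD1_seq a) //= eqxx scale1r big1 ?addr0 // => x.
  by rewrite eq_sym => /negbTE->; rewrite scale0r.
by rewrite -big_split; apply: eq_bigr => x _; rewrite /= natrD scalerDl.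
Qed.

Lemma lin_span_family (V : lmodType rat) (X : set V) d (b : 'I_d -> V) v :
  (forall i, X (b i)) -> (forall x, X x -> exists i, x = b i) ->
  lin_span X v <-> exists c : 'I_d -> rat, v = \sum_i c i *: b i.
Proof.
move=> Xb bX; split=> [[s [sX ->]]|[c ->]]; last first.
  exists [seq (c i, b i) | i <- index_enum 'I_d].
  by rewrite big_map; split=> // _ /mapP[i _ ->]; apply: Xb.
elim: s sX => [|[a x] s IHs] sX.
  by exists (fun=> 0); rewrite big_nil big1 // => i _; rewrite scale0r.
have [c cE] : exists c : 'I_d -> rat, \sum_(y <- s) y.1 *: y.2 = \sum_i c i *: b i.
  by apply: IHs => y ys; apply: sX; rewrite inE ys orbT.
have [i /= xi] := bX _ (sX _ (mem_head _ _)).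
exists (fun l => (i == l)%:R * a + c l); rewrite big_cons cE /= xi.
under [RHS]eq_bigr do rewrite scalerDl.
rewrite big_split /=; congr (_ + _); rewrite (bigD1 i) //= eqxx mul1r.
by rewrite big1 ?addr0 // => l; rewrite eq_sym => /negbTE->; rewrite mul0r scale0r.
Qed.

(** Both multisets of shuffles have the same sum of images, namely the product of the images, and
    independence of the terms forces equal multiplicities. *)
Lemma lpkdes_shuffle_compatible : shuffle_compatible lpkdes.
Proof.
move=> p q p' q' pq pq' ep eq lp lq.
pose n := (len p + len q)%N; pose term jk := lpkdes_term jk.1 jk.2 n.
pose A := map lpkdes (shuffles p q); pose B := map lpkdes (shuffles p' q').
have sumE r s : (len r + len s)%N = n -> disjoint_perm r s ->
    \sum_(jk <- map lpkdes (shuffles r s)) term jk = lpkdes_image r * lpkdes_image s.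
  move=> rs drs; rewrite lpkdes_image_shuffles // big_map big_seq [RHS]big_seq.
  by apply: eq_bigr => w /len_shuffles; rewrite rs lpkdes_imageE => ->.
have imgE r s : len r = len s -> lpkdes r = lpkdes s -> lpkdes_image r = lpkdes_image s.
  by rewrite !lpkdes_imageE => -> [-> ->].
pose U := undup (A ++ B).
have AU : {subset A <= U} by move=> x xA; rewrite mem_undup mem_cat xA.
have BU : {subset B <= U} by move=> x xB; rewrite mem_undup mem_cat xB orbT.
have sum0 : \sum_(x <- U) ((count_mem x A)%:R - (count_mem x B)%:R) *: term x = 0.
  under eq_bigr do rewrite scalerBl.
  rewrite sumrB -!sum_count_mem ?undup_uniq // !sumE -?lp -?lq //.
  by rewrite (imgE p p') // (imgE q q') // subrr.
have valid x : x \in U -> (x.1 <= x.2)%N.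
  rewrite mem_undup mem_cat => /orP[] /mapP[w _ ->];
    by have /and3P[] := valid_stat_lpkdes w.
have c0 := @lpkdes_term_free _ U (fun x => (n, x)) _ (undup_uniq _) _ valid sum0.
apply/allP => x; rewrite -mem_undup => xU.
by rewrite /= -(Num.Theory.eqr_nat rat) -subr_eq0 c0 // => y z _ _ [].
Qed.

Local Notation cl := (st_class lpkdes).

Definition class_key (c : cl) : nat * (nat * nat) := (len (repr c), lpkdes (repr c)).

Lemma class_keyE p : class_key (\pi_cl p) = (len p, lpkdes p).
Proof.
have /eqmodP/andP[/eqP lp /eqP sp] := reprK (\pi_cl p).
by rewrite /class_key lp sp.
Qed.

Lemma class_key_inj : injective class_key.
Proof.
move=> c d [lcd scd1 scd2]; rewrite -[c]reprK -[d]reprK; apply/eqmodP.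
by rewrite /= /st_eqv lcd /lpkdes scd1 scd2 !eqxx.
Qed.

Definition class_image (c : cl) : hpoly :=
  lpkdes_term (class_key c).2.1 (class_key c).2.2 (class_key c).1.

Lemma class_imageE p : class_image (\pi_cl p) = lpkdes_image p.
Proof. by rewrite /class_image class_keyE lpkdes_imageE. Qed.

Definition lpkdes_map (u : shuffle_alg lpkdes) : hpoly :=
  mmap (in_alg hpoly) class_image u.

Lemma lpkdes_mapE u : lpkdes_map u = \sum_(c <- msupp u) u@_c *: class_image c.
Proof. by rewrite /lpkdes_map mmapE; apply: eq_bigr => c _; rewrite mulr_algl. Qed.

Lemma lpkdes_map_is_linear : linear lpkdes_map.
Proof.
move=> a u v; rewrite /lpkdes_map mmapD; congr (_ + _).
rewrite (mmapEw (d := msupp u)) ?msuppZ_le // mmapE scaler_sumr.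
by apply: eq_bigr => c _; rewrite mcoeffZ /= !mulr_algl scalerA.
Qed.

HB.instance Definition _ := GRing.isLinear.Build rat (shuffle_alg lpkdes) hpoly
  *:%R lpkdes_map lpkdes_map_is_linear.

Lemma lpkdes_map_cls p : lpkdes_map (cls lpkdes p) = lpkdes_image p.
Proof. by rewrite /lpkdes_map mmapU /= scale1r mul1r class_imageE. Qed.

Lemma lpkdes_map_one : lpkdes_map (shuffle_one lpkdes) = 1.
Proof.
rewrite lpkdes_map_cls lpkdes_image_gf /len SubK /= mulr1 -polyC1; congr _%:P.
apply/polyP => i; rewrite coef_hadamard_y coefC inv_1Bt coef1.
by case: i => [|i]; apply: hpsP.
Qed.

Lemma lpkdes_map_class_mul (c d : cl) :
  lpkdes_map (class_mul c d) = class_image c * class_image d.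
Proof.
rewrite /class_mul /disjoint_reprs.
case: xgetP => [[p q] _ [/= pq <- <-]|no_reprs].
  rewrite !class_imageE lpkdes_image_shuffles // linear_sum.
  by apply: eq_bigr => r _; rewrite /= lpkdes_map_cls.
(* Disjoint representatives always exist, so the default of [xget] is never taken. *)
have [q [pq lq sq]] := disjoint_copy (repr c) (repr d).
case: (no_reprs (repr c, q)); split; rewrite ?reprK //=.
by rewrite -[d]reprK; apply/eqmodP; rewrite /= /st_eqv lq sq !eqxx.
Qed.

Lemma lpkdes_mapM u v :
  lpkdes_map (shuffle_mul u v) = lpkdes_map u * lpkdes_map v.
Proof.
rewrite /shuffle_mul linear_sum !lpkdes_mapE big_distrlr /=.
apply: eq_bigr => c _; rewrite linear_sum; apply: eq_bigr => d _.
by rewrite linearZ /= lpkdes_map_class_mul -scalerAl -scalerAr scalerA.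
Qed.

Lemma lpkdes_map_inj : injective lpkdes_map.
Proof.
apply: raddf_inj => u u0; have := u0 : lpkdes_map u = 0.
rewrite lpkdes_mapE => {}u0.
apply/malgP => c; rewrite mcoeff0.
case: msuppP => // cu.
apply: (lpkdes_term_free (fset_uniq _) _ _ u0 cu).
  by move=> x y _ _; apply: class_key_inj.
by move=> x _; have /and3P[] := valid_stat_lpkdes (repr x).
Qed.

Lemma lpkdes_map_realize n j k : valid_stat n (j, k) ->
  exists2 p, len p = n & lpkdes_map (cls lpkdes p) = lpkdes_term j k n.
Proof.
move=> /lpkdes_realize[p [<- [lp dp]]]; exists p => //.
by rewrite lpkdes_map_cls lpkdes_imageE lp dp.
Qed.

Lemma lpkdes_term00 n : lpkdes_term 0 0 n =
  hadamard ((1 + var_y * var_t) ^+ n * over_1Bt n.+1 * var_x ^+ n).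
Proof. by rewrite /lpkdes_term !mul1r mulr1 !subn0. Qed.

Lemma lpkdes_map_range : range lpkdes_map = lpkdes_span.
Proof.
apply/seteqP; split=> [_ [u _ <-]|P [s [sX ->]]].
  exists [seq (u@_c, class_image c) | c <- msupp u].
  rewrite big_map lpkdes_mapE; split=> // _ /mapP[c _ ->] /=.
  have := valid_stat_lpkdes (repr c); rewrite /class_image /class_key /lpkdes /=.
  move: (len _) (lpk _) (des _) => n j k /and3P[/= jk jkn j0].
  (* Length 0 gives the unit and j = 0 the family of 1 + yt; otherwise 1 <= j <= k and j + k <= n
     make [n] at least 2. *)
  have [n0|n0] := posnP n.
    by left; left; rewrite /= unit_eltE n0; congr lpkdes_term; lia.
  have [ej|j1] := posnP j.
    left; right; exists n; split=> //; rewrite -lpkdes_term00.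
    by rewrite ej in j0 *; rewrite (eqP j0).
  by right; exists n, j, k; split=> //; lia.
elim: s sX => [|[a Q] s IHs] sX.
  by exists 0 => //; rewrite big_nil linear0.
have [v _ vE] : range lpkdes_map (\sum_(x <- s) x.1 *: x.2).
  by apply: IHs => x xs; apply: sX; rewrite inE xs orbT.
suff [p pQ] : exists p, lpkdes_map (cls lpkdes p) = Q.
  by exists (a *: cls lpkdes p + v) => //; rewrite linearP big_cons /= pQ vE.
have := sX _ (mem_head _ _) => /= -[[->|[n [n1 ->]]]|[n [j [k [n2 j1 jk ->]]]]].
- by have [p _ pE] := @lpkdes_map_realize 0 0 0 isT; exists p; rewrite unit_eltE.
- rewrite -lpkdes_term00.
  by have [p _ pE] := @lpkdes_map_realize n 0 0 isT; exists p.
have njk : valid_stat n (j, k) by rewrite /valid_stat /=; lia.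
by have [p _ pE] := lpkdes_map_realize njk; exists p.
Qed.

(** The span is the range of a multiplicative linear map that sends [shuffle_one] to 1. *)
Lemma lpkdes_span_subalg : subalg_closed (mem lpkdes_span).
Proof.
have spanP P : reflect (exists u, lpkdes_map u = P) (P \in mem lpkdes_span).
  rewrite -lpkdes_map_range; apply: (iffP idP) => [Pr|[u <-]].
    by have /set_mem[u _ <-] : P \in range lpkdes_map := Pr; exists u.
  by have : lpkdes_map u \in range lpkdes_map by apply/mem_set; exists u.
split=> [|a _ _ /spanP[u <-] /spanP[v <-]|_ _ /spanP[u <-] /spanP[v <-]].
- by apply/spanP; exists (shuffle_one lpkdes); apply: lpkdes_map_one.
- by apply/spanP; exists (a *: u + v); rewrite linearP.
- by apply/spanP; exists (shuffle_mul u v); rewrite lpkdes_mapM.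
Qed.

Lemma has_dim_hom_component n : has_dim (hom_component lpkdes n) (n ^ 2 %/ 4).+1.
Proof.
rewrite -size_valid_stats; set d := size _.
pose key (i : 'I_d) := nth (0, 0)%N (valid_stats n) i.
have key_valid i : valid_stat n (key i) by rewrite -mem_valid_stats mem_nth.
(* One permutation is chosen for each attained pair; the classes form a basis, independent because
   their images are. *)
have [P PE] := choice (fun i => lpkdes_realize (key_valid i)).
have Pn i : len (P i) = n by have [] := PE i.
have Pk i : lpkdes (P i) = key i by have [] := PE i.
have clsP p : len p = n -> exists i, cls lpkdes p = cls lpkdes (P i).
  move=> lp; have : lpkdes p \in valid_stats n.
    by rewrite mem_valid_stats -lp valid_stat_lpkdes.
  rewrite -index_mem => id; exists (Ordinal id); congr << _ >>.
  apply/eqmodP; rewrite /= /st_eqv Pn lp Pk /key nth_index ?eqxx //.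
  by rewrite -index_mem.
exists (fun i => cls lpkdes (P i)); split=> [c c0 i|v].
  have := congr1 lpkdes_map c0; rewrite linear0 linear_sum => sum0.
  apply: (@lpkdes_term_free _ (index_enum 'I_d) (fun i => (n, key i)) c).
  - exact: index_enum_uniq.
  - move=> x y _ _ [/eqP]; rewrite nth_uniq ?uniq_valid_stats // => /eqP.
    exact: val_inj.
  - by move=> x _; have /and3P[] := key_valid x.
  - rewrite -[RHS]sum0; apply: eq_bigr => x _.
    by rewrite linearZ /= lpkdes_map_cls lpkdes_imageE -[(lpk _)]/((lpkdes _).1)
      -[(des _)]/((lpkdes _).2) Pk Pn.
  exact: mem_index_enum.
apply: lin_span_family => i; first by exists (P i).
by case=> p /= /clsP[l pl] <-; exists l.
Qed.

End Isomorphism.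

Local Open Scope classical_set_scope.

Theorem theorem5p10 :
  shuffle_compatible lpkdes /\
  (exists Phi : {linear shuffle_alg lpkdes -> hpoly},
     [/\ forall p : permutation, Phi (cls lpkdes p) = lpkdes_image p,
         Phi (shuffle_one lpkdes) = 1,
         forall u v : shuffle_alg lpkdes,
           Phi (shuffle_mul u v) = Phi u * Phi v,
         injective Phi
       & range Phi = lpkdes_span]) /\
  subalg_closed (mem lpkdes_span) /\
  (forall n : nat, has_dim (hom_component lpkdes n) (n ^ 2 %/ 4).+1).
Proof.
split; first exact: lpkdes_shuffle_compatible.
split; last first.
  by split; [exact: lpkdes_span_subalg|exact: has_dim_hom_component].
exists lpkdes_map; split.
- exact: lpkdes_map_cls.
- exact: lpkdes_map_one.
- exact: lpkdes_mapM.
- exact: lpkdes_map_inj.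
- exact: lpkdes_map_range.
Qed.
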